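(* Let $p\in\mathbb H$, $R>0$, and let $f$ be a left slice hyperholomorphic function in an axially symmetric open neighbourhood of $p$ containing the Cassini ball $U(p,R)$, where it admits a spherical expansion $$f(q)=\sum_{n=0}^\infty Q_p^n(q)\,[a_{2n}+(q-p)a_{2n+1}],\qquad\{a_n\}_{n\in\mathbb N_0}\subseteq\mathbb H,$$ absolutely and uniformly convergent on the compact subsets of $U(p,R)$. Then $h=\bar Df$ has, for $q\in U(p,R)$, the expansion $$h(q)=\bar Df(q)=4\sum_{n=0}^\infty(n+1)(q-p_0)Q_p^n(q)[a_{2n+2}+(q-p)a_{2n+3}]+4\sum_{n=0}^\infty(q_0-p_0)\mathcal L_{n+1}(q,p)[a_{2n+2}+(\bar q-p)a_{2n+3}]+4\sum_{n=0}^\infty Q_p^n(q)a_{2n+1}.$$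
   Context: $\mathbb H$ denotes the quaternions $q=q_0+q_1e_1+q_2e_2+q_3e_3$ with the usual relations ($e_i^2=-1$, $e_1e_2=-e_2e_1=e_3$, $e_2e_3=-e_3e_2=e_1$, $e_3e_1=-e_1e_3=e_2$), $\underline q=q_1e_1+q_2e_2+q_3e_3$, $\bar q=q_0-\underline q$, $\mathbb S=\{\underline q:|\underline q|=1\}$, $[q]=\{q_0+I|\underline q|:I\in\mathbb S\}$; a set $U$ is axially symmetric if $[q]\subset U$ for all $q\in U$. Slice hyperholomorphic: for $U$ axially symmetric open and $\mathcal U=\{(u,v)\in\mathbb R^2:u+\mathbb Sv\subset U\}$, $f:U\to\mathbb H$ is left slice hyperholomorphic if $f(u+Iv)=\alpha(u,v)+I\beta(u,v)$ for all $(u,v)\in\mathcal U$, $I\in\mathbb S$, with $C^1$ functions $\alpha,\beta:\mathcal U\to\mathbb H$, $\alpha$ even and $\beta$ odd in $v$, satisfying $\partial_u\alpha=\partial_v\beta$, $\partial_v\alpha=-\partial_u\beta$. $\bar D=\partial_{q_0}-e_1\partial_{q_1}-e_2\partial_{q_2}-e_3\partial_{q_3}$ acting from the left, in $q$. $p_0=\mathrm{Re}(p)$; $Q_p(q)=q^2-2p_0q+|p|^2$, $Q_p^n(q)=(Q_p(q))^n$. The Cassini ball is $U(p,R)=\{q\in\mathbb H:|Q_p(q)|<R^2\}$. For $n\ge1$, $\mathcal L_n(q,p)=\sum_{k=0}^{n-1}\overline{Q_p^{\,n-1-k}(q)}\,Q_p^k(q)$. *)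

(* Defs.v *)
From HB Require Import structures.
From mathcomp Require Import all_boot all_order all_algebra.
From mathcomp Require Import all_classical all_reals all_analysis.
From mathcomp Require Import ring lra.
Set Implicit Arguments.
Unset Strict Implicit.
Unset Printing Implicit Defensive.
Import Order.TTheory GRing.Theory Num.Theory numFieldNormedType.Exports.
Local Open Scope classical_set_scope.
Local Open Scope ring_scope.

Record quaternion (R : Type) := Quaternion { qre : R; qim1 : R; qim2 : R; qim3 : R }.

Section QuaternionAlgebra.
Context {R : realType}.
Local Notation H := (quaternion R).

Definition tuple_of_quaternion (q : H) := (qre q, qim1 q, qim2 q, qim3 q).
Definition quaternion_of_tuple (t : R * R * R * R) : H :=
  let: (a, b, c, d) := t in Quaternion a b c d.

Lemma tuple_of_quaternionK : cancel tuple_of_quaternion quaternion_of_tuple.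
Proof. by case. Qed.

HB.instance Definition _ := Choice.copy H (can_type tuple_of_quaternionK).

Lemma quaternionP (a b : H) :
  qre a = qre b -> qim1 a = qim1 b -> qim2 a = qim2 b -> qim3 a = qim3 b -> a = b.
Proof. by case: a b => ? ? ? ? [] ? ? ? ? /= -> -> -> ->. Qed.

Definition qzero : H := Quaternion 0 0 0 0.
Definition qopp (a : H) : H := Quaternion (- qre a) (- qim1 a) (- qim2 a) (- qim3 a).
Definition qadd (a b : H) : H :=
  Quaternion (qre a + qre b) (qim1 a + qim1 b) (qim2 a + qim2 b) (qim3 a + qim3 b).

Lemma qaddA : associative qadd.
Proof. by move=> a b c; apply: quaternionP => /=; rewrite addrA. Qed.
Lemma qaddC : commutative qadd.
Proof. by move=> a b; apply: quaternionP => /=; rewrite addrC. Qed.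
Lemma qadd0 : left_id qzero qadd.
Proof. by move=> a; apply: quaternionP => /=; rewrite add0r. Qed.
Lemma qaddN : left_inverse qzero qopp qadd.
Proof. by move=> a; apply: quaternionP => /=; rewrite addNr. Qed.

HB.instance Definition _ := GRing.isZmodule.Build H qaddA qaddC qadd0 qaddN.

Definition qone : H := Quaternion 1 0 0 0.
Definition qmul (a b : H) : H := Quaternion
  (qre a * qre b - qim1 a * qim1 b - qim2 a * qim2 b - qim3 a * qim3 b)
  (qre a * qim1 b + qim1 a * qre b + qim2 a * qim3 b - qim3 a * qim2 b)
  (qre a * qim2 b - qim1 a * qim3 b + qim2 a * qre b + qim3 a * qim1 b)
  (qre a * qim3 b + qim1 a * qim2 b - qim2 a * qim1 b + qim3 a * qre b).

Lemma qmulA : associative qmul.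
Proof. by move=> a b c; apply: quaternionP => /=; ring. Qed.
Lemma qmul1l : left_id qone qmul.
Proof. by move=> a; apply: quaternionP => /=; ring. Qed.
Lemma qmul1r : right_id qone qmul.
Proof. by move=> a; apply: quaternionP => /=; ring. Qed.
Lemma qmulDl : left_distributive qmul qadd.
Proof. by move=> a b c; apply: quaternionP => /=; ring. Qed.
Lemma qmulDr : right_distributive qmul qadd.
Proof. by move=> a b c; apply: quaternionP => /=; ring. Qed.
Lemma qone_neq0 : qone != 0.
Proof. by apply/eqP => -[] /eqP; rewrite oner_eq0. Qed.

HB.instance Definition _ := GRing.Zmodule_isNzRing.Build H
  qmulA qmul1l qmul1r qmulDl qmulDr qone_neq0.

Definition qscale (r : R) (a : H) : H :=
  Quaternion (r * qre a) (r * qim1 a) (r * qim2 a) (r * qim3 a).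

Lemma qscaleA r s (a : H) : qscale r (qscale s a) = qscale (r * s) a.
Proof. by apply: quaternionP => /=; ring. Qed.
Lemma qscale1 : left_id 1 qscale.
Proof. by move=> a; apply: quaternionP => /=; ring. Qed.
Lemma qscaleDr : right_distributive qscale +%R.
Proof. by move=> r a b; apply: quaternionP => /=; ring. Qed.
Lemma qscaleDl (a : H) : {morph qscale^~ a : r s / r + s}.
Proof. by move=> r s; apply: quaternionP => /=; ring. Qed.

HB.instance Definition _ := GRing.Zmodule_isLmodule.Build R H
  qscaleA qscale1 qscaleDr qscaleDl.

Lemma qscaleAl (r : R) (a b : H) : r *: (a * b) = (r *: a) * b.
Proof. by apply: quaternionP => /=; ring. Qed.
Lemma qscaleAr (r : R) (a b : H) : r *: (a * b) = a * (r *: b).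
Proof. by apply: quaternionP => /=; ring. Qed.

HB.instance Definition _ := GRing.Lmodule_isLalgebra.Build R H qscaleAl.
HB.instance Definition _ := GRing.Lalgebra_isAlgebra.Build R H qscaleAr.

Definition qnorm (a : H) : R :=
  Num.sqrt (qre a ^+ 2 + qim1 a ^+ 2 + qim2 a ^+ 2 + qim3 a ^+ 2).

Lemma qnormZ (r : R) (a : H) : qnorm (r *: a) = `|r| * qnorm a.
Proof.
rewrite /qnorm -sqrtr_sqr -sqrtrM ?sqr_ge0//; congr Num.sqrt.
by rewrite /=; ring.
Qed.

Lemma qnorm0_eq0 (a : H) : qnorm a = 0 -> a = 0.
Proof.
move/eqP; rewrite sqrtr_eq0 => h.
have := sqr_ge0 (qre a); have := sqr_ge0 (qim1 a); have := sqr_ge0 (qim2 a).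
have := sqr_ge0 (qim3 a) => ? ? ? ?.
by apply: quaternionP => /=; apply/eqP; rewrite -sqrf_eq0 eq_le; lra.
Qed.

Lemma qnormD (a b : H) : qnorm (a + b) <= qnorm a + qnorm b.
Proof.
pose N (c : H) := qre c ^+ 2 + qim1 c ^+ 2 + qim2 c ^+ 2 + qim3 c ^+ 2.
have N0 c : 0 <= N c by rewrite !addr_ge0 ?sqr_ge0.
pose t := qre a * qre b + qim1 a * qim1 b + qim2 a * qim2 b + qim3 a * qim3 b.
have CS : t <= qnorm a * qnorm b.
  rewrite -sqrtrM ?N0//; apply: le_trans (ler_norm _) _.
  rewrite -sqrtr_sqr; apply: ler_wsqrtr.
  rewrite -subr_ge0 [leRHS](_ : _ =
    (qre a * qim1 b - qim1 a * qre b) ^+ 2 + (qre a * qim2 b - qim2 a * qre b) ^+ 2 +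
    (qre a * qim3 b - qim3 a * qre b) ^+ 2 + (qim1 a * qim2 b - qim2 a * qim1 b) ^+ 2 +
    (qim1 a * qim3 b - qim3 a * qim1 b) ^+ 2 + (qim2 a * qim3 b - qim3 a * qim2 b) ^+ 2).
    by rewrite !addr_ge0 ?sqr_ge0.
  by rewrite /t; ring.
have nab0 : 0 <= qnorm a + qnorm b by rewrite addr_ge0 ?sqrtr_ge0.
rewrite -(ger0_norm nab0) -sqrtr_sqr; apply: ler_wsqrtr.
have sq c : qnorm c ^+ 2 = N c by rewrite sqr_sqrtr ?N0.
have -> : (qnorm a + qnorm b) ^+ 2 = N a + N b + (qnorm a * qnorm b) *+ 2.
  by rewrite [LHS]sqrrD !sq; ring.
rewrite -subr_ge0 /N /=.
rewrite [leRHS](_ : _ = (qnorm a * qnorm b - t) *+ 2); last by rewrite /t; ring.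
by rewrite mulrn_wge0 ?subr_ge0.
Qed.

HB.instance Definition _ :=
  Lmodule_isNormed.Build R H qnormD qnormZ qnorm0_eq0.

End QuaternionAlgebra.

Section SliceHyperholomorphic.
Context {R : realType}.
Local Notation H := (quaternion R).

Definition e1 : H := Quaternion 0 1 0 0.
Definition e2 : H := Quaternion 0 0 1 0.
Definition e3 : H := Quaternion 0 0 0 1.

Definition vecpart (q : H) : H := Quaternion 0 (qim1 q) (qim2 q) (qim3 q).
Definition qconj (q : H) : H := (qre q)%:A - vecpart q.

Definition imag_sphere : set H := [set I | qre I = 0 /\ `|I| = 1].

Definition sphere_of (q : H) : set H :=
  [set (qre q)%:A + `|vecpart q| *: I | I in imag_sphere].

Definition axially_symmetric (U : set H) :=
  forall q, U q -> sphere_of q `<=` U.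

Definition slice_domain (U : set H) : set (R * R) :=
  [set x | forall I, imag_sphere I -> U (x.1%:A + x.2 *: I)].

Definition du (g : R * R -> H) (x : R * R) : H := 'D_(1, 0) g x.
Definition dv (g : R * R -> H) (x : R * R) : H := 'D_(0, 1) g x.

(* Meant for open A, such as slice_domain U for U open. *)
Definition C1_on (A : set (R * R)) (g : R * R -> H) :=
  (forall x, A x -> derivable g x (1, 0) /\ derivable g x (0, 1)) /\
  {within A, continuous (du g)} /\ {within A, continuous (dv g)}.

(* Meant for U open and axially symmetric; f is only constrained on U. *)
Definition left_slice_hyperholomorphic (U : set H) (f : H -> H) :=
  exists alpha beta : R * R -> H,
  [/\ C1_on (slice_domain U) alpha, C1_on (slice_domain U) beta,
      forall u v, slice_domain U (u, v) ->
        alpha (u, - v) = alpha (u, v) /\ beta (u, - v) = - beta (u, v),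
      forall x, slice_domain U x ->
        du alpha x = dv beta x /\ dv alpha x = - du beta x
    & forall u v I, slice_domain U (u, v) -> imag_sphere I ->
        f (u%:A + v *: I) = alpha (u, v) + I * beta (u, v)].

Definition has_partials (f : H -> H) (q : H) :=
  [/\ derivable f q 1, derivable f q e1, derivable f q e2
    & derivable f q e3].

Definition Dbar (f : H -> H) (q : H) : H :=
  'D_1 f q - e1 * 'D_e1 f q - e2 * 'D_e2 f q - e3 * 'D_e3 f q.

Definition Qp (p q : H) : H :=
  q ^+ 2 - (2 * qre p) *: q + (`|p| ^+ 2)%:A.

Definition cassini_ball (p : H) (r : R) : set H :=
  [set q | `|Qp p q| < r ^+ 2].

Definition Lpoly (n : nat) (q p : H) : H :=
  \sum_(k < n) qconj (Qp p q ^+ (n - 1 - k)) * Qp p q ^+ k.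

Definition spherical_term (p : H) (a : nat -> H) (n : nat) (q : H) : H :=
  Qp p q ^+ n * (a (2 * n)%N + (q - p) * a (2 * n + 1)%N).

(* f is the sum of its spherical series on the Cassini ball, the convergence
   being absolute and uniform on compact subsets. *)
Definition spherical_expansion (p : H) (r : R) (a : nat -> H) (f : H -> H) :=
  forall K : set H, compact K -> K `<=` cassini_ball p r ->
    (forall q, K q -> cvgn [normed series (spherical_term p a ^~ q)]) /\
    {uniform K, (fun N q => \sum_(0 <= n < N) spherical_term p a n q) @ \oo
      --> f}.

End SliceHyperholomorphic.

(* Main.v *)
(* The spherical terms at the two conjugate points of p_0 + i R where |Q_p| = s
   bound |a_{2n}| and |a_{2n+1}| by C s^-n for every s < r^2.  Hence, in every
   direction d, the first-order Taylor remainder of the n-th term at q is at most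
   t^2 M x^n with x < 1, so the series may be differentiated termwise.  For a
   single term, Q_p(q)^n = x + y q with x, y real, and
   Dbar (Q_p^{n+1}) = (Dbar Q_p^n) Q_p + X(Q_p^n) where
   X(w) = 4 (q - p_0) w + 4 (q_0 - p_0) conj(w); the closed form
   4 n (q - p_0) Q_p^{n-1} + 4 (q_0 - p_0) L_n obeys the same recursion. *)
Require Import Defs.
From mathcomp Require Import all_boot all_order all_algebra.
From mathcomp Require Import all_classical all_reals all_analysis.
From mathcomp Require Import ring lra.
Import Order.TTheory GRing.Theory Num.Theory numFieldNormedType.Exports.
Local Open Scope classical_set_scope.
Local Open Scope ring_scope.

(** * Norm, series and differentiation tools on the quaternions *)

Section QuaternionNorm.
Context {R : realType}.
Local Notation H := (quaternion R).
Implicit Types (a b c q : H).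

Lemma quaternion_normE q : `|q| = Num.sqrt (qre q ^+ 2 + qim1 q ^+ 2 + qim2 q ^+ 2 + qim3 q ^+ 2).
Proof. by []. Qed.

Lemma quaternion_normM a b : `|a * b| = `|a| * `|b|.
Proof.
rewrite !quaternion_normE -sqrtrM ?addr_ge0 ?sqr_ge0//.
by congr Num.sqrt => /=; ring.
Qed.

Lemma quaternion_norm1 : `|1 : H| = 1.
Proof. by rewrite quaternion_normE /= expr1n !expr0n !addr0 sqrtr1. Qed.

Lemma quaternion_norm_nat n : `|n%:R : H| = n%:R.
Proof. by rewrite -scaler_nat normrZ quaternion_norm1 mulr1 normr_nat. Qed.

Lemma quaternion_normX q n : `|q ^+ n| = `|q| ^+ n.
Proof.
elim: n => [|n IH]; first by rewrite !expr0 quaternion_norm1.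
by rewrite !exprS quaternion_normM IH.
Qed.

Lemma quaternion_norm_conj q : `|qconj q| = `|q|.
Proof.
by rewrite !quaternion_normE; congr Num.sqrt => /=; ring.
Qed.

Lemma qconjM a b : qconj (a * b) = qconj b * qconj a.
Proof. by apply: quaternionP => /=; ring. Qed.

Lemma qconjX q n : qconj (q ^+ n) = qconj q ^+ n.
Proof.
elim: n => [|n IH]; last by rewrite exprS qconjM IH exprSr.
by rewrite !expr0; apply: quaternionP => /=; ring.
Qed.

Lemma quaternion_coordE q :
  q = qre q *: 1 + qim1 q *: e1 + qim2 q *: e2 + qim3 q *: e3.
Proof. by apply: quaternionP => /=; ring. Qed.

Lemma coord_norm_le q : [/\ `|qre q| <= `|q|, `|qim1 q| <= `|q|,
  `|qim2 q| <= `|q| & `|qim3 q| <= `|q|].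
Proof.
have := sqr_ge0 (qre q); have := sqr_ge0 (qim1 q); have := sqr_ge0 (qim2 q).
have := sqr_ge0 (qim3 q) => h0 h1 h2 h3.
by split; rewrite quaternion_normE -sqrtr_sqr ler_wsqrtr//; lra.
Qed.

Lemma cvg_qmull (c l : H) (u : H^nat) : u @ \oo --> l -> c * u n @[n --> \oo] --> c * l.
Proof.
move=> ul; apply/subr_cvg0/norm_cvg0P.
rewrite (_ : (fun _ => _) = fun n => `|c| * `|u n - l|); last first.
  by apply/funext => n; rewrite -mulrBr quaternion_normM.
rewrite -[X in _ --> X](mulr0 `|c|); apply: cvgMr.
by apply/norm_cvg0P/subr_cvg0.
Qed.

Lemma norm_lim_le (u : H^nat) (l : H) (M : R) : u @ \oo --> l ->
  (forall n, `|u n| <= M) -> `|l| <= M.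
Proof.
move=> /(@cvg_norm _ _ _ _ _ u l) ul uM.
rewrite -(cvg_lim _ ul)//; apply: limr_le; last exact: nearW.
by apply/cvg_ex; exists `|l|.
Qed.

Lemma series_geometric_bound (u : H^nat) (A x : R) : 0 <= A -> 0 < x < 1 ->
  (forall n, `|u n| <= A * x ^+ n) -> forall N, `|series u N| <= A / (1 - x).
Proof.
move=> A0 /andP[x0 x1] uA N.
rewrite /series /=; apply: le_trans (ler_norm_sum _ _ _) _.
have /(le_trans _): series (geometric A x) N <= A / (1 - x).
  by apply: geometric_le_lim => //; rewrite gtr0_norm.
by apply; rewrite /series /=; apply: ler_sum => n _; exact: uA.
Qed.

(** Each real coordinate is at most the norm, so the four coordinate series converge by comparison;
    the quaternionic series is rebuilt from them along [1], [e1], [e2], [e3]. *)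
Lemma series_geometric_cvg (u : H^nat) (A x : R) : 0 <= A -> 0 < x < 1 ->
  (forall n, `|u n| <= A * x ^+ n) -> cvgn (series u).
Proof.
move=> A0 /andP[x0 x1] uA.
have scal (v : R^nat) : (forall n, `|v n| <= `|u n|) -> cvgn (series v).
  move=> vu; apply: normed_cvg.
  apply: (@series_le_cvg _ _ (geometric A x)) => //.
  - by move=> n /=; exact: normr_ge0.
  - by move=> n; rewrite /geometric /= mulr_ge0// exprn_ge0// ltW.
  - by move=> n; exact: le_trans (vu n) (uA n).
  - by apply: is_cvg_geometric_series; rewrite gtr0_norm.
have c0 : cvgn (series (@qre R \o u)) by apply: scal => n /=; have [] := coord_norm_le (u n).
have c1 : cvgn (series (@qim1 R \o u)) by apply: scal => n /=; have [] := coord_norm_le (u n).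
have c2 : cvgn (series (@qim2 R \o u)) by apply: scal => n /=; have [] := coord_norm_le (u n).
have c3 : cvgn (series (@qim3 R \o u)) by apply: scal => n /=; have [] := coord_norm_le (u n).
have -> : series u = fun n => series (@qre R \o u) n *: (1 : H) + series (@qim1 R \o u) n *: e1
   + series (@qim2 R \o u) n *: e2 + series (@qim3 R \o u) n *: e3.
  apply/funext => n; rewrite /series /= !scaler_suml -!big_split /=.
  by apply: eq_bigr => i _; exact: quaternion_coordE.
apply: is_cvgD; last exact: is_cvgZl.
apply: is_cvgD; last exact: is_cvgZl.
apply: is_cvgD; exact: is_cvgZl.
Qed.

(** The difference quotient misses [l] by at most [|t| C]. A remainder bound of this form survives
    sums and limits, which suits termwise differentiation. *)
Lemma derive_quadratic_remainder (f : H -> H) (q d l : H) (delta C : R) :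
  0 < delta -> 0 <= C ->
  (forall t, `|t| <= delta -> `|f (q + t *: d) - f q - t *: l| <= t ^+ 2 * C) ->
  is_derive q d f l.
Proof.
move=> d0 C0 hf.
suff h : h^-1 *: ((f \o shift q) (h *: d) - f q) @[h --> 0^'] --> l.
  apply: DeriveDef; first by apply/cvg_ex; exists l.
  exact: cvg_lim h.
apply/cvgrPdistC_le => e e0.
near=> t.
have t0 : t != 0 by near: t; exact: nbhs_dnbhs_neq.
have td : `|t| <= delta by near: t; exact: dnbhs0_le.
(* The denominator [C + 1] covers the case [C = 0]. *)
have te : `|t| <= e / (C + 1) by near: t; apply: dnbhs0_le; rewrite divr_gt0// ltr_wpDl.
have -> : t^-1 *: ((f \o shift q) (t *: d) - f q) - l =
    t^-1 *: (f (q + t *: d) - f q - t *: l).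
  by rewrite /= [t *: d + q]addrC [RHS]scalerBr scalerA mulVf// scale1r.
rewrite normrZ normfV mulrC ler_pdivrMr ?normr_gt0//.
apply: le_trans (hf _ td) _.
rewrite -real_normK ?num_real// expr2 mulrC mulrA ler_wpM2r//.
have C1 : 0 < C + 1 by rewrite ltr_wpDl.
move: te; rewrite ler_pdivlMr// => te; apply: le_trans te.
by rewrite mulrC ler_wpM2l//; lra.
Unshelve. all: by end_near. Qed.

End QuaternionNorm.

(** * Directional derivatives of noncommutative powers *)

Section PowerDerivative.
Context {R : realType}.
Local Notation H := (quaternion R).
Implicit Types (x y z : H).

(* The derivative of x |-> x^n in the direction y, which need not commute with x. *)
Fixpoint dpow x y n : H :=
  if n is m.+1 then dpow x y m * x + x ^+ m * y else 0.

(** The [n] summands have size at most [|y| u^(n-1)], and the larger ratio [v] absorbs the factor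
    [n]. The constant [A = |y| / (v - u)] solves [A v^(n+1) = A v^n u + v^n |y|]. *)
Lemma dpow_bound x y (u v : R) (n : nat) : 0 <= u < v -> `|x| <= u ->
  `|dpow x y n| <= `|y| / (v - u) * v ^+ n.
Proof.
move=> /andP[u0 uv] xu; have vu : 0 < v - u by rewrite subr_gt0.
have v0 : 0 < v by exact: le_lt_trans uv.
elim: n => [|n IH] /=.
  by rewrite normr0 !mulr_ge0 ?invr_ge0 ?exprn_ge0// ltW.
apply: le_trans (ler_normD _ _) _; rewrite !quaternion_normM quaternion_normX.
have -> : `|y| / (v - u) * v ^+ n.+1 =
    `|y| / (v - u) * v ^+ n * u + v ^+ n * `|y|.
  by rewrite exprS; field; rewrite gt_eqF.
apply: lerD; first by apply: ler_pM.
by rewrite ler_wpM2r// lerXn2r ?nnegrE//; apply: ltW => //; exact: le_lt_trans xu uv.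
Qed.

(** The curve [x + t y + t^2 z] is what [Qp] traces along a line ([Qp_jet]). What matters is that
    [B] depends on neither [t] nor [n]. *)
Lemma pow_jet x y z (u v : R) : 0 <= u < v -> `|x| <= u ->
  exists2 B, 0 <= B & forall t n, `|t| <= 1 ->
    `|x + t *: y + t ^+ 2 *: z| <= u ->
    `|(x + t *: y + t ^+ 2 *: z) ^+ n - x ^+ n - t *: dpow x y n|
      <= t ^+ 2 * (B * v ^+ n).
Proof.
move=> uv0 xu; have /andP[u0 uv] := uv0.
have vu : 0 < v - u by rewrite subr_gt0.
have v0 : 0 < v by exact: le_lt_trans uv.
pose A := `|y| / (v - u).
have A0 : 0 <= A by rewrite divr_ge0// ltW.
(* The summands bound what each induction step adds at order [t^2]: [x^n z], [D y] and [t D z] with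
   [D = dpow x y n]. *)
pose K := `|z| + A * `|y| + A * `|z|.
have K0 : 0 <= K by rewrite !addr_ge0// mulr_ge0.
exists (K / (v - u)); first by rewrite divr_ge0// ltW.
move=> t n t1 wu; set w := x + _ + _ in wu *.
elim: n => [|n IH] /=.
  rewrite !expr0 subrr scaler0 subr0 normr0 mulr_ge0 ?sqr_ge0//.
  by rewrite mulr1 divr_ge0// ltW.
have -> : w ^+ n.+1 - x ^+ n.+1 - t *: (dpow x y n * x + x ^+ n * y) =
   (w ^+ n - x ^+ n - t *: dpow x y n) * w +
   t ^+ 2 *: (x ^+ n * z + dpow x y n * y + t *: (dpow x y n * z)).
  rewrite !exprSr /w; move: (_ ^+ n) (x ^+ n) (dpow x y n) => W X D.
  by apply: quaternionP => /=; ring.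
apply: le_trans (ler_normD _ _) _.
have -> : t ^+ 2 * (K / (v - u) * v ^+ n.+1) =
  t ^+ 2 * (K / (v - u) * v ^+ n) * u + t ^+ 2 * (K * v ^+ n).
  by rewrite [v ^+ n.+1]exprS; field; rewrite gt_eqF.
apply: lerD; first by rewrite quaternion_normM ler_pM.
rewrite normrZ ger0_norm ?sqr_ge0// ler_wpM2l ?sqr_ge0//.
apply: le_trans (ler_normD _ _) _.
rewrite /K [leRHS]mulrDl; apply: lerD.
  apply: le_trans (ler_normD _ _) _; rewrite mulrDl.
  apply: lerD; rewrite quaternion_normM.
    rewrite mulrC ler_wpM2l// quaternion_normX.
    by rewrite lerXn2r ?nnegrE//; apply: ltW => //; exact: le_lt_trans xu uv.
  by rewrite mulrAC ler_wpM2r// dpow_bound.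
rewrite normrZ quaternion_normM -[leRHS]mul1r ler_pM// 1?mulrAC ?ler_wpM2r//.
exact: dpow_bound.
Qed.

Lemma succ_geometric_bound (u v : R) n : 0 <= u < v ->
  n.+1%:R * u ^+ n <= v / (v - u) * v ^+ n.
Proof.
move=> /andP[u0 uv]; have vu : 0 < v - u by rewrite subr_gt0.
have v0 : 0 < v by exact: le_lt_trans uv.
elim: n => [|n IH].
  by rewrite !expr0 !mulr1 ler_pdivlMr//; lra.
rewrite -natr1 mulrDl mul1r.
have -> : v / (v - u) * v ^+ n.+1 = u * (v / (v - u) * v ^+ n) + v ^+ n.+1.
  by rewrite exprS; field; rewrite gt_eqF.
apply: lerD; first by rewrite exprS mulrCA ler_wpM2l.
by rewrite lerXn2r ?nnegrE//; exact: ltW.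
Qed.

End PowerDerivative.

(** * Closed form of [Dbar] on a single spherical term *)

Section DbarAlgebra.
Context {R : realType}.
Local Notation H := (quaternion R).
Implicit Types (p q d b c w : H).

Definition dQp p q d : H := q * d + d * q - (2 * qre p) *: d.

Lemma Qp_jet p q d (t : R) :
  Qp p (q + t *: d) = Qp p q + t *: dQp p q d + t ^+ 2 *: (d * d).
Proof. by rewrite /Qp /dQp; apply: quaternionP; rewrite !expr2 /=; ring. Qed.

(* Dbar f q is dirac_conj applied to d |-> 'D_d f q. *)
Definition dirac_conj (g : H -> H) : H := g 1 - e1 * g e1 - e2 * g e2 - e3 * g e3.

Lemma dirac_conjD (g h : H -> H) :
  dirac_conj (fun d => g d + h d) = dirac_conj g + dirac_conj h.
Proof. by rewrite /dirac_conj !mulrDr; apply: quaternionP => /=; ring. Qed.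

Lemma dirac_conjMr (g : H -> H) c : dirac_conj (fun d => g d * c) = dirac_conj g * c.
Proof. by rewrite /dirac_conj !mulrBl !mulrA. Qed.

Lemma dirac_conj_sum (g : nat -> H -> H) N :
  dirac_conj (fun d => \sum_(0 <= n < N) g n d) = \sum_(0 <= n < N) dirac_conj (g n).
Proof. by rewrite /dirac_conj !mulr_sumr -!sumrB. Qed.

(** The real span of [1] and [q], a commutative subalgebra; powers of [Qp p q] stay in it and so
    commute with [q]. *)
Definition in_slice q w := exists x y : R, w = x%:A + y *: q.

(** From [q^2 = 2 q_0 q - |q|^2]. *)
Lemma in_slice_Qp p q : in_slice q (Qp p q).
Proof.
exists (`|p| ^+ 2 - `|q| ^+ 2), (2 * qre q - 2 * qre p).
rewrite /Qp quaternion_normE [in X in _ = X]quaternion_normE.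
rewrite !sqr_sqrtr ?addr_ge0 ?sqr_ge0//.
by apply: quaternionP; rewrite !expr2 /=; ring.
Qed.

Lemma in_sliceM q w w' : in_slice q w -> in_slice q w' -> in_slice q (w * w').
Proof.
move=> [x [y ->]] [x' [y' ->]].
exists (x * x' - y * y' * `|q| ^+ 2), (x * y' + y * x' + y * y' * 2 * qre q).
rewrite quaternion_normE sqr_sqrtr ?addr_ge0 ?sqr_ge0//.
by apply: quaternionP; rewrite !expr2 /=; ring.
Qed.

Lemma in_sliceX q w n : in_slice q w -> in_slice q (w ^+ n).
Proof.
move=> wq; elim: n => [|n IH]; last by rewrite exprS; exact: in_sliceM.
by exists 1, 0; rewrite scale1r scale0r addr0 expr0.
Qed.

(** In [w - e1 w e1 - e2 w e2 - e3 w e3] the vector part cancels and four times the real part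
    remains. *)
Lemma dirac_conj_slice q w : in_slice q w ->
  dirac_conj (fun d => w * d) = 2 * (w + qconj w).
Proof.
by move=> [x [y ->]]; rewrite /dirac_conj mulr_natl mulr2n; apply: quaternionP => /=; ring.
Qed.

(** The parts [(w q) d], [(w d) q] and [-2 p_0 w d] each fall under [dirac_conj_slice], and [q]
    commutes with [w]. With [w = Qp^n] this is the inhomogeneous term of the recursion for
    [Dbar (Qp^n)]. *)
Lemma dirac_conj_dQp p q w : in_slice q w ->
  dirac_conj (fun d => w * dQp p q d) =
  4 * (q - (qre p)%:A) * w + 4 * ((qre q)%:A - (qre p)%:A) * qconj w.
Proof.
move=> [x [y ->]]; rewrite /dirac_conj /dQp (_ : 4 = 4 *: (1 : H)); last by rewrite scaler_nat.
rewrite -!scalerAl !mul1r.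
by apply: quaternionP => /=; ring.
Qed.

Lemma LpolyS p q n : Lpoly n.+1 q p = Lpoly n q p * Qp p q + qconj (Qp p q) ^+ n.
Proof.
rewrite /Lpoly big_ord_recl /= expr0 mulr1 subn0 subn1 /= qconjX addrC; congr +%R.
rewrite mulr_suml; apply: eq_bigr => i _.
rewrite -mulrA -exprSr /bump leq0n; congr (qconj (_ ^+ _) * _).
by rewrite -subnDA.
Qed.

(** The vector part of [Qp p q] is [2 (q_0 - p_0)] times that of [q]. *)
Lemma Qp_subconj p q :
  Qp p q - qconj (Qp p q) = 2 * ((qre q)%:A - (qre p)%:A) * (q - qconj q).
Proof.
rewrite (_ : 2 = 2 *: (1 : H)); last by rewrite scaler_nat.
rewrite -!scalerAl mul1r /Qp; apply: quaternionP; rewrite !expr2 /=; ring.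
Qed.

Lemma dirac_conj_Qp p q n :
  dirac_conj (fun d => dpow (Qp p q) (dQp p q d) n) =
  4 * n%:R * (q - (qre p)%:A) * Qp p q ^+ n.-1
   + 4 * ((qre q)%:A - (qre p)%:A) * Lpoly n q p.
Proof.
elim: n => [|n IH].
  rewrite /= mulr0 !mul0r /Lpoly big_ord0 mulr0 addr0.
  by rewrite /dirac_conj !mulr0 !subr0.
rewrite /= dirac_conjD dirac_conjMr IH.
rewrite (dirac_conj_dQp p q _ (in_sliceX _ _ n (in_slice_Qp p q))).
rewrite LpolyS qconjX.
move: (q - _) (4 * ((qre q)%:A - _)) (Qp p q) => y g Q.
rewrite mulrDl mulrDr mulrA addrACA; congr (_ + _).
rewrite -!mulrA -mulrDr; congr (4 * _); rewrite -natr1 mulrDl mul1r.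
(* At [n = 0] the truncated exponent [n.-1] is harmless because the coefficient [n] is zero. *)
by case: n {IH} => [|n]; rewrite ?mul0r//= exprSr.
Qed.

(** Telescoping factorisation of [A^n - B^n] for the commuting pair [A = Qp p q], [B = qconj A]. *)
Lemma Lpoly_subconj p q n :
  Lpoly n q p * (Qp p q - qconj (Qp p q)) = Qp p q ^+ n - qconj (Qp p q) ^+ n.
Proof.
have comm : qconj (Qp p q) * Qp p q = Qp p q * qconj (Qp p q).
  by apply: quaternionP => /=; ring.
elim: n => [|n IH]; first by rewrite /Lpoly big_ord0 mul0r !expr0 subrr.
rewrite LpolyS mulrDl -mulrA mulrBr -comm -mulrBl mulrA IH mulrBl mulrBr.
by rewrite -!exprSr addrA subrK.
Qed.

(** This is where [qconj q] enters the second bracket. Replacing [q] by it costs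
    [4 (q_0 - p_0) L_n (q - qconj q) c], which [Qp_subconj] and [Lpoly_subconj] turn into
    [2 (Q^n - conj Q^n) c]; together with [2 (Q^n + conj Q^n) c] from differentiating [q - p] this
    makes [4 Q^n c]. *)
Lemma dirac_conj_spherical p q b c n :
  dirac_conj (fun d => dpow (Qp p q) (dQp p q d) n * (b + (q - p) * c)
    + Qp p q ^+ n * (d * c)) =
  4 * n%:R * (q - (qre p)%:A) * Qp p q ^+ n.-1 * (b + (q - p) * c)
  + 4 * ((qre q)%:A - (qre p)%:A) * Lpoly n q p * (b + (qconj q - p) * c)
  + 4 * Qp p q ^+ n * c.
Proof.
have sub : 2 * ((qre q)%:A - (qre p)%:A) * Lpoly n q p * (q - qconj q) =
    Qp p q ^+ n - qconj (Qp p q ^+ n).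
  rewrite qconjX -Lpoly_subconj Qp_subconj (_ : 2 = 2 *: (1 : H)); last by rewrite scaler_nat.
  by move: (Lpoly n q p) => L; rewrite -!scalerAl mul1r; apply: quaternionP => /=; ring.
have slice := dirac_conj_slice q _ (in_sliceX _ _ n (in_slice_Qp p q)).
rewrite dirac_conjD dirac_conjMr dirac_conj_Qp mulrDl -!addrA; congr (_ + _).
rewrite (_ : (fun d => Qp p q ^+ n * (d * c)) = fun d => (Qp p q ^+ n * d) * c); last first.
  by apply/funext => d; rewrite mulrA.
rewrite dirac_conjMr slice.
have -> : b + (q - p) * c = b + (qconj q - p) * c + (q - qconj q) * c.
  by rewrite -addrA -mulrDl [qconj q - p + _]addrC addrA subrK.
rewrite [in LHS]mulrDr -!addrA; congr (_ + _).
rewrite mulrA -mulrDl; congr (_ * _).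
have -> : 4 * ((qre q)%:A - (qre p)%:A) * Lpoly n q p * (q - qconj q) =
    2 * (2 * ((qre q)%:A - (qre p)%:A) * Lpoly n q p * (q - qconj q)).
  by rewrite !mulrA -natrM.
rewrite sub -mulrDr addrACA addNr addr0 mulrDr -mulrDl.
by rewrite -natrD.
Qed.

End DbarAlgebra.

(** * Coefficient bounds and termwise differentiation *)

Section SphericalSeries.
Context {R : realType}.
Local Notation H := (quaternion R).
Implicit Types (p q d b c w : H) (a : nat -> H) (f : H -> H) (r : R).

Lemma spherical_expansion_cvg p r a f q : spherical_expansion p r a f ->
  cassini_ball p r q -> series (spherical_term p a ^~ q) @ \oo --> f q.
Proof.
move=> fexp qr.
have c1 : compact [set q] by exact: compact_set1.
have s1 : [set q] `<=` cassini_ball p r by move=> z ->.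
have [_] := fexp _ c1 s1.
by rewrite uniform_set1.
Qed.

(** A term is at most the sum of all norms, finite by absolute convergence. *)
Lemma spherical_term_bounded p r a f q : spherical_expansion p r a f ->
  cassini_ball p r q -> exists C, forall n, `|spherical_term p a n q| <= C.
Proof.
move=> fexp qr.
have c1 : compact [set q] by exact: compact_set1.
have s1 : [set q] `<=` cassini_ball p r by move=> z ->.
have [/(_ q erefl) cv _] := fexp _ c1 s1.
exists (limn [normed series (spherical_term p a ^~ q)]) => n.
(* The partial sum at [n.+1] is the first to contain term [n]. *)
apply: (@le_trans _ _ ([normed series (spherical_term p a ^~ q)] n.+1)).
  by rewrite /= seriesEord /= big_ord_recr /= lerDr sumr_ge0.
apply: nondecreasing_cvgn_le cv _.
by apply/nondecreasing_seqP => m; rewrite /= seriesEord /= [leRHS]big_ord_recr lerDl.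
Qed.

Lemma affine_norm_le b c w (K : R) : `|b| <= K -> `|c| <= K ->
  `|b + w * c| <= (1 + `|w|) * K.
Proof.
move=> bK cK; apply: le_trans (ler_normD _ _) _.
by rewrite quaternion_normM mulrDl mul1r lerD// ler_wpM2l.
Qed.

(* The points p_0 +- t e_1 with t^2 = |vec p|^2 + s both have Q_p = -s, and
   subtracting the two spherical terms isolates the odd coefficient. *)
Lemma spherical_coef_bound p r a f (s : R) : spherical_expansion p r a f ->
  0 < s < r ^+ 2 -> exists C, [/\ 0 <= C, forall n, `|a (2 * n)%N| <= C * s^-1 ^+ n
    & forall n, `|a (2 * n + 1)%N| <= C * s^-1 ^+ n].
Proof.
move=> fexp /andP[s0 sr].
pose m := qim1 p ^+ 2 + qim2 p ^+ 2 + qim3 p ^+ 2 + s.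
have m0 : 0 < m by rewrite ltr_wpDl// !addr_ge0 ?sqr_ge0.
pose t := Num.sqrt m.
have t0 : 0 < t by rewrite sqrtr_gt0.
have t2 : t * t = m by rewrite -expr2 sqr_sqrtr// ltW.
pose z (e : R) : H := Quaternion (qre p) (e * t) 0 0.
have Qz e : e * e = 1 -> Qp p (z e) = (- s)%:A.
  move=> e2; rewrite /Qp quaternion_normE sqr_sqrtr ?addr_ge0 ?sqr_ge0//.
  have e2t2 : e * t * (e * t) = m by rewrite mulrACA e2 t2 mul1r.
  apply: quaternionP; rewrite /= ?e2t2 /m; ring.
have nQz e : e * e = 1 -> `|Qp p (z e)| = s.
  by move=> e2; rewrite Qz// normrZ quaternion_norm1 mulr1 normrN gtr0_norm.
have Bz e : e * e = 1 -> cassini_ball p r (z e).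
  by move=> e2; rewrite /cassini_ball /= nQz.
have [C1 h1] := spherical_term_bounded p r a f (z 1) fexp (Bz 1 (mulr1 1)).
have [C2 h2] := spherical_term_bounded p r a f (z (-1)) fexp
  (Bz (-1) (etrans (mulrNN 1 1) (mulr1 1))).
have odd n : s ^+ n * `|a (2 * n + 1)%N| <= (C1 + C2) / (2 * t).
  rewrite ler_pdivlMr ?mulr_gt0//.
  have -> : 2 * t = `|z 1 - z (-1)|.
    have -> : z 1 - z (-1) = (2 * t) *: e1 by apply: quaternionP => /=; ring.
    rewrite normrZ quaternion_normE /= expr0n expr1n /= addr0 add0r !addr0 sqrtr1 mulr1.
    by rewrite gtr0_norm// mulr_gt0.
  rewrite -mulrA [X in _ * X]mulrC -quaternion_normM.
  apply: le_trans (lerD (h1 n) (h2 n)).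
  rewrite /spherical_term !quaternion_normM !quaternion_normX !nQz ?mulrNN ?mulr1//.
  rewrite -mulrDr ler_wpM2l ?exprn_ge0 ?(ltW s0)//.
  rewrite -quaternion_normM; apply: le_trans (ler_normB _ _).
  rewrite le_eqVlt; apply/orP; left; apply/eqP; congr `|_|.
  rewrite opprD addrACA subrr add0r -mulrBl; congr (_ * _).
  by rewrite opprB addrA subrK.
have C10 : 0 <= C1 by exact: le_trans (h1 0%N).
have C20 : 0 <= C2 by exact: le_trans (h2 0%N).
pose K := (C1 + C2) / (2 * t).
have K0 : 0 <= K by rewrite divr_ge0 ?addr_ge0// mulr_ge0// ltW.
(* The even coefficient is recovered from the whole bracket at [z 1] by removing the odd part just
   bounded. *)
have even n : s ^+ n * `|a (2 * n)%N| <= C1 + `|z 1 - p| * K.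
  have -> : a (2 * n)%N = (a (2 * n)%N + (z 1 - p) * a (2 * n + 1)%N)
     - (z 1 - p) * a (2 * n + 1)%N by rewrite addrK.
  apply: le_trans (ler_wpM2l _ (ler_normB _ _)) _; first by rewrite exprn_ge0 ?(ltW s0).
  rewrite mulrDr; apply: lerD.
    apply: le_trans (h1 n).
    by rewrite /spherical_term quaternion_normM quaternion_normX nQz ?mulr1.
  by rewrite quaternion_normM mulrCA ler_wpM2l//; exact: odd.
have sn n : 0 < s ^+ n by rewrite exprn_gt0.
exists (C1 + `|z 1 - p| * K + K); split.
- by rewrite !addr_ge0// mulr_ge0.
- move=> n; rewrite exprVn ler_pdivlMr// mulrC.
  by apply: le_trans (even n) _; rewrite lerDl.
- move=> n; rewrite exprVn ler_pdivlMr// mulrC.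
  by apply: le_trans (odd n) _; rewrite lerDr addr_ge0// mulr_ge0.
Qed.

Lemma cassini_geometric_bound p r a f q : spherical_expansion p r a f ->
  cassini_ball p r q -> exists u v C y : R,
  [/\ `|Qp p q| < u < v, u < r ^+ 2, 0 <= C /\ 0 < y, v * y < 1
    & forall n, `|a (2 * n)%N| <= C * y ^+ n /\ `|a (2 * n + 1)%N| <= C * y ^+ n].
Proof.
move=> fexp; rewrite /cassini_ball /=; set m := `|Qp p q| => mr.
have m0 : 0 <= m by exact: normr_ge0.
(* The values [s 1 < s 2 < s 3] cut the gap from [|Qp p q|] to [r ^+ 2] into quarters: [s 1] leaves
   room to move [q], [s 2] absorbs factors of order [n], and [(s 3)^-1] is the decay rate of the
   coefficients. *)
pose s (k : R) := m + k * (r ^+ 2 - m) / 4.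
have [|C [C0 ev od]] := spherical_coef_bound p r a f (s 3) fexp.
  by rewrite /s; lra.
exists (s 1), (s 2), C, (s 3)^-1; split=> //.
- by rewrite /s; lra.
- by rewrite /s; lra.
- by split=> //; rewrite invr_gt0 /s; lra.
- by rewrite ltr_pdivrMr /s; lra.
Qed.

Definition spherical_term_deriv p a q n d : H :=
  dpow (Qp p q) (dQp p q d) n * (a (2 * n)%N + (q - p) * a (2 * n + 1)%N)
  + Qp p q ^+ n * (d * a (2 * n + 1)%N).

(** The second factor of a term is affine in [t], so beyond the remainder of [Qp^n] there is just
    one cross term of order [t^2]. *)
Lemma spherical_term_jet p a q n d (t : R) :
  spherical_term p a n (q + t *: d) - spherical_term p a n q
    - t *: spherical_term_deriv p a q n d =
  (Qp p (q + t *: d) ^+ n - Qp p q ^+ n - t *: dpow (Qp p q) (dQp p q d) n)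
    * (a (2 * n)%N + (q + t *: d - p) * a (2 * n + 1)%N)
  + t ^+ 2 *: (dpow (Qp p q) (dQp p q d) n * (d * a (2 * n + 1)%N)).
Proof.
rewrite /spherical_term /spherical_term_deriv.
move: (Qp p (_ + _) ^+ n) (Qp p q ^+ n) (dpow _ _ _) (a _) (a _) => W X D b c.
by apply: quaternionP; rewrite /=; ring.
Qed.

(** The remainders of the terms add up to the remainder of [f], so their geometric bound yields the
    estimate required by [derive_quadratic_remainder]. *)
Lemma spherical_expansion_derive p r a f q d : spherical_expansion p r a f ->
  cassini_ball p r q ->
  cvgn (series (spherical_term_deriv p a q ^~ d)) /\
  is_derive q d f (limn (series (spherical_term_deriv p a q ^~ d))).
Proof.
move=> fexp qr.
have [u [v [C [y [/andP[Qu uv] ur [C0 y0] vy ab]]]]] := cassini_geometric_bound p r a f q fexp qr.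
have u0 : 0 < u by exact: le_lt_trans Qu.
have v0 : 0 < v by exact: lt_trans uv.
have vy0 : 0 < v * y by exact: mulr_gt0.
have vy01 : 0 < v * y < 1 by rewrite vy0.
have uv0 : 0 <= u < v by rewrite uv ltW.
have bnd n w : `|a (2 * n)%N + w * a (2 * n + 1)%N| <= (1 + `|w|) * (C * y ^+ n).
  by have [] := ab n; exact: affine_norm_le.
have odd n w : `|w * a (2 * n + 1)%N| <= `|w| * (C * y ^+ n).
  by rewrite quaternion_normM ler_wpM2l//; have [] := ab n.
pose A := `|dQp p q d| / (v - u).
have A0 : 0 <= A by rewrite divr_ge0// subr_ge0 ltW.
have D n : `|dpow (Qp p q) (dQp p q d) n| <= A * v ^+ n.
  by apply: dpow_bound uv0 _; exact: ltW.
clearbody A.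
have cG : cvgn (series (spherical_term_deriv p a q ^~ d)).
  apply: (series_geometric_cvg _ (A * (1 + `|q - p|) * C + `|d| * C) _ _ vy01).
    by rewrite addr_ge0 ?mulr_ge0// ?mulr_ge0// ?addr_ge0//.
  move=> n; apply: le_trans (ler_normD _ _) _.
  rewrite [leRHS]mulrDl; apply: lerD; rewrite quaternion_normM.
    apply: le_trans (ler_pM _ _ (D n) (bnd n _)) _ => //.
    by rewrite exprMn le_eqVlt; apply/orP; left; apply/eqP; ring.
  rewrite quaternion_normX.
  have Qv : `|Qp p q| ^+ n <= v ^+ n.
    by rewrite lerXn2r ?nnegrE//; apply: ltW => //; exact: lt_trans Qu uv.
  apply: le_trans (ler_pM _ _ Qv (odd n d)) _ => //.
  by rewrite exprMn le_eqVlt; apply/orP; left; apply/eqP; ring.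
split=> //.
have [B B0 jet] := pow_jet (Qp p q) (dQp p q d) (d * d) u v uv0 (ltW Qu).
pose N := `|dQp p q d| + `|d * d| + 1.
have N0 : 0 < N by rewrite ltr_wpDl// addr_ge0.
(* From [|t| <= 1] follows [t^2 <= |t|]; the second bound then keeps [|Qp|] at the displaced point
   at most [u], hence that point in the ball. *)
pose delta := Num.min 1 ((u - `|Qp p q|) / N).
have delta0 : 0 < delta by rewrite lt_min ltr01 divr_gt0// subr_gt0.
(* One summand for each part of [spherical_term_jet]; the extra [|d|] allows for
   [|q + t d - p| <= |q - p| + |d|]. *)
pose M := B * (1 + `|q - p| + `|d|) * C + A * `|d| * C.
have M0 : 0 <= M by rewrite addr_ge0 ?mulr_ge0// ?mulr_ge0// ?addr_ge0//.
apply: (derive_quadratic_remainder _ _ _ _ delta (M / (1 - v * y)) delta0).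
  by rewrite divr_ge0// subr_ge0 ltW.
move=> t; rewrite le_min => /andP[t1 tN].
have Qt : `|Qp p q + t *: dQp p q d + t ^+ 2 *: (d * d)| <= u.
  have tt : t ^+ 2 <= `|t|.
    by rewrite -real_normK ?num_real// expr2 ler_piMl.
  apply: le_trans (ler_normD _ _) _; rewrite normrZ ger0_norm ?sqr_ge0//.
  apply: le_trans (lerD (ler_normD _ _) (lexx _)) _; rewrite normrZ.
  have := ler_wpM2r (normr_ge0 (d * d)) tt.
  move: tN; rewrite ler_pdivlMr// /N !mulrDr mulr1; have := normr_ge0 t; lra.
have qtr : cassini_ball p r (q + t *: d).
  by rewrite /cassini_ball /= Qp_jet; exact: le_lt_trans ur.
pose E n := spherical_term p a n (q + t *: d) - spherical_term p a n q
    - t *: spherical_term_deriv p a q n d.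
have cE : series E @ \oo --> f (q + t *: d) - f q
    - t *: limn (series (spherical_term_deriv p a q ^~ d)).
  have -> : series E = fun n => series (spherical_term p a ^~ (q + t *: d)) n
     - series (spherical_term p a ^~ q) n - t *: series (spherical_term_deriv p a q ^~ d) n.
    by apply/funext => n; rewrite /series /= scaler_sumr -!sumrB.
  apply: cvgB; last exact: cvgZr.
  by apply: cvgB; apply: spherical_expansion_cvg fexp _.
have bE n : `|E n| <= (t ^+ 2 * M) * (v * y) ^+ n.
  rewrite /E spherical_term_jet; apply: le_trans (ler_normD _ _) _.
  rewrite -[leRHS]mulrA [M * _]mulrDl [leRHS]mulrDr; apply: lerD.
    rewrite quaternion_normM Qp_jet.
    apply: le_trans (ler_pM _ _ (jet t n t1 Qt) (bnd n _)) _ => //.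
    have -> : t ^+ 2 * (B * v ^+ n) * ((1 + `|q + t *: d - p|) * (C * y ^+ n)) =
       t ^+ 2 * (B * v ^+ n * (C * y ^+ n)) * (1 + `|q + t *: d - p|) by ring.
    have -> : t ^+ 2 * (B * (1 + `|q - p| + `|d|) * C * (v * y) ^+ n) =
       t ^+ 2 * (B * v ^+ n * (C * y ^+ n)) * (1 + `|q - p| + `|d|) by rewrite exprMn; ring.
    rewrite ler_wpM2l//; first by rewrite mulr_ge0 ?sqr_ge0// !mulr_ge0// exprn_ge0// ltW.
    rewrite -[leRHS]addrA lerD2l addrAC; apply: le_trans (ler_normD _ _) _.
    by rewrite lerD2l normrZ ler_piMl.
  rewrite normrZ ger0_norm ?sqr_ge0// ler_wpM2l ?sqr_ge0// quaternion_normM.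
  apply: le_trans (ler_pM _ _ (D n) (odd n d)) _ => //.
  by rewrite exprMn le_eqVlt; apply/orP; left; apply/eqP; ring.
rewrite mulrA.
apply: norm_lim_le cE _ => n.
apply: series_geometric_bound bE _ => //.
by rewrite mulr_ge0 ?sqr_ge0.
Qed.

End SphericalSeries.

(** * Convergence of the three series in the formula *)

Section DbarSeries.
Context {R : realType}.
Local Notation H := (quaternion R).
Implicit Types (p q d b c w : H) (a : nat -> H) (f : H -> H) (r : R).

Lemma cvg_dirac_conj (s : nat -> H -> H) (l : H -> H) :
  (forall d, s ^~ d @ \oo --> l d) ->
  dirac_conj (s n) @[n --> \oo] --> dirac_conj l.
Proof.
move=> sl; rewrite /dirac_conj.
apply: cvgB; last exact: cvg_qmull.
apply: cvgB; last exact: cvg_qmull.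
by apply: cvgB; [exact: sl|exact: cvg_qmull].
Qed.

Lemma Lpoly_norm_le p q n : `|Lpoly n.+1 q p| <= n.+1%:R * `|Qp p q| ^+ n.
Proof.
elim: n => [|n IH].
  by rewrite /Lpoly big_ord1 /= !expr0 mulr1 quaternion_norm_conj quaternion_norm1 mul1r.
rewrite LpolyS; apply: le_trans (ler_normD _ _) _.
rewrite quaternion_normM quaternion_normX quaternion_norm_conj -[n.+2%:R]natr1 mulrDl mul1r.
by rewrite lerD2r exprSr mulrA ler_wpM2r.
Qed.

(** Serves two series at once: [g] is [(n + 1) Qp^n] in the first and [L_(n+1)] in the second. *)
Lemma succ_series_cvg p r a f q (g : nat -> H) c w : spherical_expansion p r a f ->
  cassini_ball p r q -> (forall n, `|g n| <= n.+1%:R * `|Qp p q| ^+ n) ->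
  cvgn [series c * g n * (a (2 * n + 2)%N + w * a (2 * n + 3)%N)]_n.
Proof.
move=> fexp qr gQ.
have [u [v [C [y [/andP[Qu uv] ur [C0 y0] vy ab]]]]] := cassini_geometric_bound p r a f q fexp qr.
have Qv : 0 <= `|Qp p q| < v by rewrite normr_ge0; exact: lt_trans uv.
have v0 : 0 < v by case/andP: Qv; exact: le_lt_trans.
have vQ : 0 < v - `|Qp p q| by rewrite subr_gt0; case/andP: Qv.
have vy01 : 0 < v * y < 1 by rewrite mulr_gt0.
pose A := v / (v - `|Qp p q|).
have A0 : 0 <= A by rewrite divr_ge0// ltW.
have gA n : `|g n| <= A * v ^+ n by apply: le_trans (gQ n) _; exact: succ_geometric_bound.
clearbody A.
(* The factor [y] beside [C] comes from the index shift: term [n] carries the coefficient pair of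
   index [n + 1]. *)
apply: (series_geometric_cvg _ (`|c| * A * (1 + `|w|) * (C * y)) _ _ vy01).
  rewrite mulr_ge0//; last by rewrite mulr_ge0// ltW.
  by rewrite mulr_ge0 ?addr_ge0// mulr_ge0.
move=> n; rewrite !quaternion_normM.
have -> : `|c| * A * (1 + `|w|) * (C * y) * (v * y) ^+ n =
    `|c| * (A * v ^+ n) * ((1 + `|w|) * (C * y ^+ n.+1)) by rewrite exprMn exprS; ring.
apply: ler_pM => //.
- by rewrite ler_wpM2l.
have := ab n.+1; rewrite (_ : 2 * n.+1 = 2 * n + 2)%N ?mulnSr// => -[ev od].
by apply: affine_norm_le; rewrite // -addnA in od *.
Qed.

Lemma odd_series_cvg p r a f q : spherical_expansion p r a f -> cassini_ball p r q ->
  cvgn [series Qp p q ^+ n * a (2 * n + 1)%N]_n.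
Proof.
move=> fexp qr.
have [u [v [C [y [/andP[Qu uv] ur [C0 y0] vy ab]]]]] := cassini_geometric_bound p r a f q fexp qr.
have Qv : `|Qp p q| < v by exact: lt_trans uv.
have v0 : 0 < v by exact: le_lt_trans Qv.
have vy01 : 0 < v * y < 1 by rewrite mulr_gt0.
apply: (series_geometric_cvg _ C _ C0 vy01) => n.
rewrite quaternion_normM quaternion_normX exprMn mulrCA.
have [_ od] := ab n; apply: ler_pM => //.
by rewrite lerXn2r ?nnegrE//; exact: ltW.
Qed.

End DbarSeries.

(** Derivatives and [limn] take default values where no limit exists, so the conclusion also asserts
    the partial derivatives and the convergence. *)
Theorem theorem9p11 (R : realType) (p : quaternion R) (r : R)
    (U : set (quaternion R)) (f : quaternion R -> quaternion R)
    (a : nat -> quaternion R) (r0 : 0 < r)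
    (oU : open U) (symU : axially_symmetric U) (Up : U p)
    (ballU : cassini_ball p r `<=` U)
    (fU : left_slice_hyperholomorphic U f)
    (fexp : spherical_expansion p r a f)
    (q : quaternion R) (hq : cassini_ball p r q) :
  let p0 : quaternion R := (qre p)%:A in
  let S1 : (quaternion R)^nat := [series
    n.+1%:R * (q - p0) * Qp p q ^+ n *
      (a (2 * n + 2)%N + (q - p) * a (2 * n + 3)%N)]_n in
  let S2 : (quaternion R)^nat := [series
    ((qre q)%:A - p0) * Lpoly n.+1 q p *
      (a (2 * n + 2)%N + (qconj q - p) * a (2 * n + 3)%N)]_n in
  let S3 : (quaternion R)^nat := [series Qp p q ^+ n * a (2 * n + 1)%N]_n in
  [/\ has_partials f q, cvgn S1, cvgn S2, cvgn S3
    & Dbar f q = 4 * limn S1 + 4 * limn S2 + 4 * limn S3].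
Proof.
move=> p0 S1 S2 S3.
have c1 : cvgn S1.
  (* The natural factor is central; next to [Qp^n] it gives the shape [c * g n] of
     [succ_series_cvg]. *)
  have -> : S1 = [series (q - p0) * (n.+1%:R * Qp p q ^+ n) *
      (a (2 * n + 2)%N + (q - p) * a (2 * n + 3)%N)]_n.
    apply/funext => n; apply: eq_bigr => i _ /=.
    by rewrite [(q - p0) * (_ * _)]mulrA [(q - p0) * _]commr_nat.
  apply: (succ_series_cvg _ _ _ _ _ (fun n => n.+1%:R * Qp p q ^+ n) _ _ fexp hq) => n.
  by rewrite quaternion_normM quaternion_norm_nat quaternion_normX.
have c2 : cvgn S2 by apply: succ_series_cvg fexp hq _; exact: Lpoly_norm_le.
have c3 : cvgn S3 by exact: odd_series_cvg fexp hq.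
have D d := (spherical_expansion_derive p r a f q d fexp hq).
split=> //.
  have df d : derivable f q d by have [_ []] := D d.
  by split; exact: df.
rewrite [LHS](_ : _ = dirac_conj (fun d => 'D_d f q))//.
(* Term [0] feeds only the third series, so [n + 1] terms of the derivative series match [n] terms
   of [S1] and [S2] and [n + 1] of [S3]. *)
have lim1 : dirac_conj (fun d => series (spherical_term_deriv p a q ^~ d) n.+1)
    @[n --> \oo] --> dirac_conj (fun d => 'D_d f q).
  rewrite (cvg_shiftS (fun n => dirac_conj (fun d => series (spherical_term_deriv p a q ^~ d) n))).
  apply: cvg_dirac_conj => d; have [cd dd] := D d.
  by rewrite derive_val.
apply: (cvg_unique _ lim1) => //.
rewrite (_ : (fun n => _) = fun n => 4 * S1 n + 4 * S2 n + 4 * S3 n.+1).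
  by apply: cvgD; [apply: cvgD|]; apply: cvg_qmull => //; rewrite (cvg_shiftS S3).
apply/funext => n.
rewrite dirac_conj_sum /S1 /S2 /S3 /series /= !mulr_sumr.
have T i : dirac_conj (spherical_term_deriv p a q i) =
    4 * i%:R * (q - p0) * Qp p q ^+ i.-1 * (a (2 * i)%N + (q - p) * a (2 * i + 1)%N)
    + 4 * ((qre q)%:A - p0) * Lpoly i q p * (a (2 * i)%N + (qconj q - p) * a (2 * i + 1)%N)
    + 4 * Qp p q ^+ i * a (2 * i + 1)%N by exact: dirac_conj_spherical.
have even i : (2 * i.+1 = 2 * i + 2)%N by rewrite mulnSr.
have odd i : (2 * i.+1 + 1 = 2 * i + 3)%N by rewrite even -addnA.
rewrite (eq_bigr _ (fun i _ => T i)) !big_split /=; congr (_ + _ + _).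
(* Term [0] vanishes by its coefficient here, and by the empty sum [L_0] in the next case. *)
- rewrite big_nat_recl// mulr0 !mul0r add0r.
  by apply: eq_bigr => i _; rewrite odd even !mulrA.
- rewrite big_nat_recl// {1}/Lpoly big_ord0 mulr0 mul0r add0r.
  by apply: eq_bigr => i _; rewrite odd even !mulrA.
- by apply: eq_bigr => i _; rewrite mulrA.
Qed.
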